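(* For every real number $p \neq 0$ and all positive real numbers $a, b, c, d$, $$a : b ::^p c : d \quad\Longleftrightarrow\quad a^p : b^p ::^1 c^p : d^p .$$ That is, $a,b,c,d$ are in analogy in power $p$ if and only if $a^p, b^p, c^p, d^p$ are in analogy in power $1$ (arithmetic analogy).
   Context: For positive real numbers $x, y$ and $p \in \mathbb{R}$, the generalized mean in $p$ is $m_p(x,y) = \lim_{r \to p} \left(\tfrac12 (x^r + y^r)\right)^{1/r}$ (limit over real $r \neq 0$). Thus $m_p(x,y) = \left(\tfrac12 (x^p+y^p)\right)^{1/p}$ for $p \neq 0$, and $m_0(x,y) = \sqrt{xy}$. Four positive real numbers $a,b,c,d$ (in this order) are in analogy in power $p$, written $a : b ::^p c : d$, if and only if $m_p(a,d) = m_p(b,c)$. *)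

(* Defs.v *)
From HB Require Import structures.
From mathcomp Require Import all_boot all_order all_algebra.
From mathcomp Require Import all_classical all_reals all_analysis.

Set Implicit Arguments.
Unset Strict Implicit.
Unset Printing Implicit Defensive.

Import Order.TTheory GRing.Theory Num.Theory.
Import numFieldNormedType.Exports.

Local Open Scope classical_set_scope.
Local Open Scope ring_scope.

(* The limit is along the deleted neighbourhoods p^' of p; the point r = 0,
   where r^-1 is a junk value, is therefore never relevant: it is the deleted
   point when p = 0, and r is eventually nonzero when p != 0.  The notion is
   meant for 0 < x and 0 < y. *)
Definition gmean (R : realType) (p x y : R) : R :=
  lim ((fun r : R => ((x `^ r + y `^ r) / 2) `^ r^-1) @ p^').

(* a : b ::^p c : d, extremes a, d and means b, c. *)
Definition analogy (R : realType) (p a b c d : R) : Prop :=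
  gmean p a d = gmean p b c.

(* Main.v *)
(* For p != 0 and x, y > 0 the function whose limit defines the mean is
   continuous at p, so the mean is given by its closed formula; the claim then
   follows because u |-> u^(1/p) is injective on positive reals. *)
Require Import Defs.
From HB Require Import structures.
From mathcomp Require Import all_boot all_order all_algebra.
From mathcomp Require Import all_classical all_reals all_analysis.

Set Implicit Arguments.
Unset Strict Implicit.
Unset Printing Implicit Defensive.

Import Order.TTheory GRing.Theory Num.Theory.
Import numFieldNormedType.Exports.

Local Open Scope classical_set_scope.
Local Open Scope ring_scope.

Lemma mean_powR_gt0 (R : realType) (r x y : R) :
  0 < x -> 0 < y -> 0 < (x `^ r + y `^ r) / 2.
Proof. by move=> x0 y0; rewrite divr_gt0// addr_gt0// powR_gt0. Qed.

(** Raising to the power [p] undoes the power [p^-1], since u = u^(p^-1 * p). *)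
Lemma powR_inv_inj (R : realType) (p u v : R) :
  p != 0 -> 0 < u -> 0 < v -> u `^ p^-1 = v `^ p^-1 -> u = v.
Proof.
move=> p0 u0 v0 uv.
by rewrite -[u]powRr1 ?ltW// -[v]powRr1 ?ltW// -(mulVf p0) !powRrM uv.
Qed.

(** Positivity of [x] excludes the special case of base 0 in [powR], leaving exp(r ln x). *)
Lemma cvg_powR_exponent (R : realType) (x p : R) :
  0 < x -> x `^ r @[r --> p] --> x `^ p.
Proof.
move=> x0; rewrite /powR gt_eqF//.
apply: continuous_cvg; first exact: continuous_expR.
by apply: cvgM; [exact: cvg_id|exact: cvg_cst].
Qed.

Lemma gmean_neq0 (R : realType) (p x y : R) : p != 0 -> 0 < x -> 0 < y ->
  gmean p x y = ((x `^ p + y `^ p) / 2) `^ p^-1.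
Proof.
(* Convergence along the full neighbourhoods of [p] implies it along the deleted ones; it is
   available because inversion is continuous at [p != 0]. *)
move=> p0 x0 y0; apply: cvg_lim => //; apply: cvg_within_filter.
(* Base and exponent both vary with [r]; the exponential form turns this into a limit of a product.
   The base is positive for every [r], so the two functions agree everywhere. *)
have powE r : ((x `^ r + y `^ r) / 2) `^ r^-1 =
    expR (r^-1 * ln ((x `^ r + y `^ r) / 2)).
  by rewrite {1}/powR gt_eqF// mean_powR_gt0.
rewrite powE (funext powE).
apply: continuous_cvg; first exact: continuous_expR.
apply: cvgM; first by apply: cvgV => //; exact: cvg_id.
apply: continuous_cvg; first by apply: continuous_ln; exact: mean_powR_gt0.
by apply: cvgM; [apply: cvgD; exact: cvg_powR_exponent|exact: cvg_cst].
Qed.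

Lemma analogy_powR (R : realType) (p a b c d : R) :
  p != 0 -> 0 < a -> 0 < b -> 0 < c -> 0 < d ->
  analogy p a b c d <-> (a `^ p + d `^ p) / 2 = (b `^ p + c `^ p) / 2.
Proof.
move=> p0 a0 b0 c0 d0; rewrite /analogy (gmean_neq0 p0 a0 d0).
rewrite (gmean_neq0 p0 b0 c0); split=> [|->//].
by apply: powR_inv_inj => //; exact: mean_powR_gt0.
Qed.

Theorem theorem3 (R : realType) (p : R) (hp : p != 0) (a b c d : R)
  (ha : 0 < a) (hb : 0 < b) (hc : 0 < c) (hd : 0 < d) :
  analogy p a b c d <-> analogy 1 (a `^ p) (b `^ p) (c `^ p) (d `^ p).
Proof.
have powR1 x : (x `^ p) `^ 1 = x `^ p by rewrite powRr1 ?powR_ge0.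
(* The criterion at exponent 1 for the [p]-th powers becomes, by [powR1], the same equation as the
   criterion at [p] for [a], [b], [c], [d]. *)
have := analogy_powR (oner_neq0 R) (powR_gt0 p ha) (powR_gt0 p hb)
  (powR_gt0 p hc) (powR_gt0 p hd).
rewrite !powR1 => ->; exact: analogy_powR.
Qed.
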